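(* Let $V$ be a real vector space of finite dimension, $A\subset V$ a convex conic open subset and $\|\cdot\|:A\to\mathbb R$ a conic norm. Then $\|\cdot\|$ is continuous, its open forward and backward balls $$B^+_v(r)=\{x\in v+A:\|x-v\|<r\},\qquad B^-_v(r)=\{x\in v-A:\|v-x\|<r\}\qquad (v\in V,\ r>0)$$ are open subsets of $V$, and its indicatrix $S=\{x\in A:\|x\|=1\}$ is a topological hypersurface, which is closed as a subset of $A$ and homeomorphic to an open subset of the usual sphere.
   Context: An open subset $A\subset V$ is conic if it is non-empty and $v\in A$ implies $\lambda v\in A$ for all $\lambda>0$ (so $0\in A$ only if $A=V$). Given a convex conic open subset $A$, a conic norm is a map $\|\cdot\|:A\to\mathbb R$ such that $\|v\|\ge 0$ for all $v\in A$ with equality iff $v=0$; $\|\lambda v\|=\lambda\|v\|$ for all $\lambda>0$, $v\in A$; and $\|v+w\|\le\|v\|+\|w\|$ for all $v,w\in A$. Notation: $v\pm A=\{v\pm w:w\in A\}$. The usual sphere is the unit sphere of a Euclidean product on $V$. *)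

(* Defs.v *)
From HB Require Import structures.
From mathcomp Require Import all_boot all_order all_algebra.
From mathcomp Require Import all_classical all_reals.
From mathcomp Require Import topology normedtype convex.

Set Implicit Arguments.
Unset Strict Implicit.
Unset Printing Implicit Defensive.

Import Order.TTheory GRing.Theory Num.Theory.
Import numFieldNormedType.Exports.
Import VectorInternalTheory.

Local Open Scope classical_set_scope.
Local Open Scope ring_scope.

(* [vectType] carries no topology: [fdspace V] is V with its usual topology,
   transported from R^n by the linear coordinate isomorphism [v2r]. *)
Definition fdspace (R : realType) (V : vectType R) : Type := V.

HB.instance Definition _ (R : realType) (V : vectType R) :=
  Vector.copy (fdspace V) V.
HB.instance Definition _ (R : realType) (V : vectType R) :=
  Topological.copy (fdspace V)
    (initial_topology (v2r : V -> 'rV[R]_(dim V))).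

Definition conic (R : realType) (V : vectType R) (A : set (fdspace V)) : Prop :=
  A !=set0 /\ forall (l : R) v, 0 < l -> A v -> A (l *: v).

(* Conic norms are represented by total functions; only their values on A are
   constrained or used. *)
Definition conic_norm (R : realType) (V : vectType R) (A : set (fdspace V))
    (N : fdspace V -> R) : Prop :=
  [/\ forall v, A v -> 0 <= N v,
      forall v, A v -> (N v = 0 <-> v = 0),
      forall (l : R) v, 0 < l -> A v -> N (l *: v) = l * N v
    & forall v w, A v -> A w -> N (v + w) <= N v + N w].

Definition forward_ball (R : realType) (V : vectType R) (A : set (fdspace V))
    (N : fdspace V -> R) (v : fdspace V) (r : R) : set (fdspace V) :=
  [set v + w | w in A] `&` [set x | N (x - v) < r].

Definition backward_ball (R : realType) (V : vectType R) (A : set (fdspace V))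
    (N : fdspace V -> R) (v : fdspace V) (r : R) : set (fdspace V) :=
  [set v - w | w in A] `&` [set x | N (v - x) < r].

Definition indicatrix (R : realType) (V : vectType R) (A : set (fdspace V))
    (N : fdspace V -> R) : set (fdspace V) :=
  A `&` [set x | N x = 1].

(* f restricts to a homeomorphism from X onto Y (subspace topologies), whose
   inverse is the restriction of g. *)
Definition homeomorphism_on (T U : topologicalType) (X : set T) (Y : set U)
    (f : T -> U) (g : U -> T) : Prop :=
  [/\ forall x, X x -> Y (f x) /\ g (f x) = x,
      forall y, Y y -> X (g y) /\ f (g y) = y,
      {within X, continuous f}
    & {within Y, continuous g}].

Definition homeomorphic_sets (T U : topologicalType) (X : set T) (Y : set U) :=
  exists f g, homeomorphism_on X Y f g.

(* Codimension-one topological submanifold: around each point of S there is a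
   chart of the ambient space onto an open subset of R^n which maps S to a
   (linear) hyperplane. *)
Definition topological_hypersurface (R : realType) (V : vectType R)
    (S : set (fdspace V)) : Prop :=
  forall x, S x ->
    exists (U : set (fdspace V)) (W : set 'rV[R]_(dim V))
           (f : fdspace V -> 'rV[R]_(dim V)) (g : 'rV[R]_(dim V) -> fdspace V)
           (H : {vspace 'rV[R]_(dim V)}),
      [/\ open U /\ U x, open W, homeomorphism_on U W f g,
          (\dim H).+1 = dim V
        & f @` (U `&` S) = W `&` [set y | y \in H]].

(* [{dot V for idfun}]: symmetric positive definite bilinear forms. *)
Definition euclidean_sphere (R : realType) (V : vectType R)
    (B : {dot fdspace V for @idfun R}) : set (fdspace V) :=
  [set x | B x x = 1].

(* Main.v *)
(* A conic norm is sublinear on an open convex cone, hence bounded above near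
   each point by its values at the vertices of a small cross-polytope;
   homogeneity turns this bound into an estimate
   [|N (v + h) - N v| <= C |h|], so N is continuous and the balls, which are
   preimages of [A `&` [set x | N x < r]] under affine maps, are open.
   Since every open ray spanned by a nonzero vector of A meets the indicatrix
   exactly once, the indicatrix is the image of [sphere `&` A] under
   [y |-> y / N y], and the radial coordinate N straightens it locally into a
   hyperplane. *)
From HB Require Import structures.
Require Import Defs.
From mathcomp Require Import all_boot all_order all_algebra.
From mathcomp Require Import all_classical all_reals.
From mathcomp Require Import topology normedtype convex.
From mathcomp Require Import interval_inference realfun ring.
Import Order.TTheory GRing.Theory Num.Theory.
Import numFieldNormedType.Exports.
Import VectorInternalTheory.
Local Open Scope classical_set_scope.
Local Open Scope ring_scope.

Set Implicit Arguments.
Unset Strict Implicit.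
Unset Printing Implicit Defensive.

(** * The coordinate norm on [fdspace V] *)

Section FdspaceNorm.
Variables (R : realType) (V : vectType R).
Implicit Types v w : fdspace V.

(** The sup norm of the coordinates. Its balls are those of the pseudometric pulled back along
    [v2r], so the normed module structure built on it induces the initial topology already fixed on
    [fdspace V]. *)
Definition fdnorm v : R := `|v2r v|.

Lemma fdnormD v w : fdnorm (v + w) <= fdnorm v + fdnorm w.
Proof. by rewrite /fdnorm linearD ler_normD. Qed.

Lemma fdnorm0_eq0 v : fdnorm v = 0 -> v = 0.
Proof.
by move/eqP; rewrite normr_eq0 -(linear0 (@v2r R V)) => /eqP/v2r_inj.
Qed.

Lemma fdnormMn v n : fdnorm (v *+ n) = fdnorm v *+ n.
Proof. by rewrite /fdnorm linearMn normrMn. Qed.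

Lemma fdnormN v : fdnorm (- v) = fdnorm v.
Proof. by rewrite /fdnorm linearN normrN. Qed.

HB.instance Definition _ := isPointed.Build (fdspace V) 0.

HB.instance Definition _ :=
  PseudoMetric.copy (fdspace V) (initial_topology (v2r : V -> 'rV[R]_(dim V))).

HB.instance Definition _ := Num.Zmodule_isNormed.Build R (fdspace V)
  fdnormD fdnorm0_eq0 fdnormMn fdnormN.

Lemma fdspace_norm_ball : @ball _ (fdspace V) = ball_ (fun x => `|x|).
Proof.
rewrite predeq3E => x e y.
change (ball (v2r x) e (v2r y) <-> `|v2r (x - y)| < e).
by rewrite linearB mx_norm_ball.
Qed.

HB.instance Definition _ :=
  NormedZmod_PseudoMetric_eq.Build R (fdspace V) fdspace_norm_ball.

Lemma fdnormZ (l : R) v : `|l *: v| = `|l| * `|v|.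
Proof. by rewrite [LHS]/Num.norm/= /fdnorm linearZ normrZ. Qed.

HB.instance Definition _ :=
  PseudoMetricNormedZmod_Lmodule_isNormedModule.Build R (fdspace V) fdnormZ.

Lemma v2r_continuous : continuous (v2r : fdspace V -> 'rV[R]_(dim V)).
Proof. exact: initial_continuous. Qed.

Lemma r2v_continuous : continuous (r2v : 'rV[R]_(dim V) -> fdspace V).
Proof.
suff : continuous (r2v : 'rV[R]_(dim V) ->
    initial_topology (v2r : V -> 'rV[R]_(dim V))) by [].
apply: continuous_comp_initial => x.
rewrite (_ : v2r \o r2v = id); first exact: cvg_id.
by apply/funext => y /=; rewrite r2vK.
Qed.

Lemma coord_le_norm v i : `|v2r v 0 i| <= `|v|.
Proof.
rewrite [leRHS]/Num.norm/= /fdnorm [leRHS]/Num.norm/= mx_normrE.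
exact: (le_bigmax _ (fun ij => `|v2r v ij.1 ij.2|) (0, i)).
Qed.

Lemma fdspace_sum_coord v :
  v = \sum_i v2r v 0 i *: (r2v 'e_i : fdspace V).
Proof.
rewrite -[LHS](v2rK v) {1}(row_sum_delta (v2r v)) linear_sum.
by apply: eq_bigr => i _; rewrite linearZ.
Qed.

End FdspaceNorm.

(** The kernel of the [j]-th coordinate form has codimension one by rank-nullity: the form takes the
    value 1 at ['e_j], so its image is a line. *)
Lemma coord_hyperplane (F : fieldType) n (j : 'I_n) :
  exists H : {vspace 'rV[F]_n},
    (\dim H).+1 = n /\ forall z, (z \in H) = (z 0 j == 0).
Proof.
pose f := linfun (mulmxr (delta_mx j 0 : 'M[F]_(n, 1)) : 'rV[F]_n -> 'M[F]_1).
have fE z : f z = (z 0 j)%:M.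
  rewrite lfunE/= [LHS]mx11_scalar; congr (_%:M).
  by rewrite mxE (bigD1 j)//= mxE !eqxx mulr1 big1 ?addr0// => i ij;
    rewrite mxE (negPf ij) mulr0.
exists (lker f); split => [|z]; last first.
  rewrite memv_ker fE -scalemx1 scaler_eq0.
  by rewrite (negPf (matrix_nonzero1 _ 0)) orbF.
have := limg_ker_dim f fullv; rewrite capfv dimvf dim_matrix mul1r => dimf.
rewrite -[RHS]dimf (_ : \dim (limg f) = 1%N) ?addn1//.
apply/eqP; rewrite eqn_leq; apply/andP; split.
  by rewrite (leq_trans (dimvS (subvf _)))// dimvf dim_matrix.
rewrite lt0n dimv_eq0; apply: contraTneq (memv_img f (memvf 'e_j)) => ->.
by rewrite memv0 fE mxE !eqxx -scalemx1 scale1r (matrix_nonzero1 _ 0).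
Qed.

(** * Sublinearity on the cone and continuity *)

Section ConicNorm.
Variables (R : realType) (V : vectType R).
Variables (A : set (fdspace V)) (N : fdspace V -> R).
Hypotheses (openA : open A) (convexA : convex_set A) (conicA : conic A).
Hypothesis normN : conic_norm A N.
Implicit Types (v w x y : fdspace V) (r s : R).

Lemma conicZ r v : 0 < r -> A v -> A (r *: v).
Proof. by case: conicA => _; apply. Qed.

Lemma conic_normZ r v : 0 < r -> A v -> N (r *: v) = r * N v.
Proof. by case: normN => _ _ + _; apply. Qed.

Lemma conic_norm_gt0 v : A v -> v != 0 -> 0 < N v.
Proof.
case: normN => N0 N_eq0 _ _ Av v0; rewrite lt_neqAle N0// andbT.
by apply: contra_neq v0 => /esym /(N_eq0 _ Av).
Qed.

(** The sum is twice the midpoint. *)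
Lemma convex_conicD v w : A v -> A w -> A (v + w).
Proof.
move=> Av Aw.
have h0 : 0 <= (2^-1 : R) by rewrite invr_ge0.
have h1 : (2^-1 : R) <= 1 by rewrite invf_le1 ?ler1n.
have : A (2^-1 *: v + (1 - 2^-1) *: w).
  by have := @convexA v w (Itv01 h0 h1); rewrite !inE; apply.
move=> /(conicZ (ltr0n R 2)); rewrite scalerDr !scalerA mulrBr mulr1.
by rewrite mulfV ?pnatr_eq0// -[2 - 1]/(1 + 1 - 1) addrK !scale1r.
Qed.

(** The case [s = 0] is treated apart: homogeneity covers positive scalars only, and [0] may lie
    outside [A]. The summand [v] keeps the sum in [A]. *)
Lemma conic_norm_addZ v w s : A v -> A w -> 0 <= s ->
  A (v + s *: w) /\ N (v + s *: w) <= N v + s * N w.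
Proof.
move=> Av Aw; rewrite le_eqVlt => /predU1P[<-|s0].
  by rewrite scale0r mul0r !addr0.
have Asw := conicZ s0 Aw; split; first exact: convex_conicD.
by rewrite -conic_normZ//; case: normN => _ _ _; apply.
Qed.

Lemma conic_norm_add_sum (I : Type) (r : seq I) v (s : I -> R)
    (w : I -> fdspace V) : A v -> (forall i, 0 <= s i) -> (forall i, A (w i)) ->
  A (v + \sum_(i <- r) s i *: w i) /\
  N (v + \sum_(i <- r) s i *: w i) <= N v + \sum_(i <- r) s i * N (w i).
Proof.
move=> Av s0 Aw; elim: r => [|i r [IHA IHN]]; first by rewrite !big_nil !addr0.
rewrite !big_cons [X in v + X]addrC [X in N v + X]addrC !addrA.
have [? le] := conic_norm_addZ IHA (Aw i) (s0 i); split=> //.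
by rewrite (le_trans le)// lerD2r.
Qed.

(* Near [v], [v + h] is a convex combination of [v] and the vertices
   [v +- d e_i] of a cross-polytope contained in A. *)
Lemma conic_norm_locally_le v : A v -> exists2 e : R, 0 < e &
  exists2 C : R, 0 <= C &
    forall h, `|h| < e -> A (v + h) /\ N (v + h) <= N v + C * `|h|.
Proof.
move=> Av.
have [d0 /= d0_gt0 d0A] : exists2 d : R, 0 < d & ball v d `<=` A.
  by apply/nbhs_ballP/open_nbhs_nbhs.
pose e (i : 'I_(dim V)) : fdspace V := r2v 'e_i.
(* [K] is positive in every dimension and bounds each [|e i|]; with the factor 2 in [d], the
   vertices lie within [d0 / 2] of [v], hence in [A]. *)
pose K := 1 + \sum_(i < dim V) `|e i|.
have K1 : 1 <= K by rewrite lerDl sumr_ge0.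
have K0 : 0 < K := lt_le_trans ltr01 K1.
pose d := d0 / (2 * K).
have dgt0 : 0 < d by rewrite divr_gt0// mulr_gt0.
pose p i (b : bool) : fdspace V := v + ((-1) ^+ b * d) *: e i.
have Ap i b : A (p i b).
  apply: d0A; rewrite -ball_normE /ball_/= /p opprD addrA subrr add0r normrN.
  rewrite normrZ normrM normrX normrN1 expr1n mul1r gtr0_norm//.
  have eK : `|e i| <= K.
    by rewrite /K (bigD1 i)//= addrCA lerDl addr_ge0// sumr_ge0.
  rewrite /d mulrAC ltr_pdivrMr ?mulr_gt0// ltr_pM2l//.
  by rewrite (le_lt_trans eK)// ltr_pMl// ltr1n.
(* Since [N] is nonnegative on [A], this sum bounds its value at every vertex. *)
pose M := \sum_(i < dim V) (N (p i false) + N (p i true)).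
have N0 w : A w -> 0 <= N w by case: normN => + _ _ _; apply.
have M0 : 0 <= M by apply: sumr_ge0 => i _; rewrite addr_ge0 ?N0.
have pM i b : N (p i b) <= M.
  apply: (@le_trans _ _ (N (p i false) + N (p i true))).
    by case: b; [rewrite lerDr|rewrite lerDl]; exact: N0.
  by rewrite /M (bigD1 i)//= lerDl sumr_ge0// => j _; rewrite addr_ge0 ?N0.
(* This radius keeps the total vertex weight, at most [dim V * |h| / d], below 1; the successor
   keeps it positive in dimension zero. The constant [C] is that weight bound per unit of [|h|],
   times [M]. *)
exists (d / (dim V).+1%:R); first by rewrite divr_gt0.
exists ((dim V)%:R / d * M); first by rewrite mulr_ge0// divr_ge0// ltW.
move=> h; rewrite ltr_pdivlMr// => hd.
(* [b i] selects the vertex on the side of the sign of [a i], so that weight [s i] contributes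
   exactly [a i *: e i]; the remaining weight goes to [v]. *)
pose a i := v2r h 0 i; pose b i := a i < 0; pose s i := `|a i| / d.
have s0 i : 0 <= s i by rewrite divr_ge0// ltW.
have ssum : \sum_i s i <= (dim V)%:R / d * `|h|.
  rewrite (_ : (dim V)%:R / d * `|h| = \sum_(i < dim V) `|h| / d).
    by apply: ler_sum => i _; rewrite ler_pM2r ?invr_gt0// coord_le_norm.
  by rewrite sumr_const card_ord -[RHS]mulr_natl [LHS]mulrAC -mulrA.
have t0 : 0 < 1 - \sum_i s i.
  rewrite subr_gt0 (le_lt_trans ssum)// mulrAC ltr_pdivrMr// mul1r mulrC.
  by rewrite (le_lt_trans _ hd)// ler_wpM2l// ler_nat.
have -> : v + h = (1 - \sum_i s i) *: v + \sum_i s i *: p i (b i).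
  rewrite (eq_bigr (fun i => s i *: v + a i *: e i)) => [|i _].
    rewrite big_split/= -[X in _ + (X + _)]scaler_suml.
    rewrite -[X in _ + (_ + X)]fdspace_sum_coord.
    by rewrite addrA -scalerDl subrK scale1r.
  rewrite scalerDr scalerA; congr (_ + _ *: _).
  rewrite mulrCA divfK ?gt_eqF// /b.
  have [an|ap] := ltP; first by rewrite expr1 ltr0_norm// mulN1r opprK.
  by rewrite expr0 mul1r ger0_norm.
have [? le] := conic_norm_add_sum (index_enum _) (conicZ t0 Av) s0
  (fun i => Ap i (b i)).
split=> //; apply: (le_trans le); rewrite conic_normZ//; apply: lerD.
  by rewrite ler_piMl ?N0// gerBl sumr_ge0.
rewrite mulrAC (le_trans _ (ler_wpM2r M0 ssum))// mulr_suml.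
by apply: ler_sum => i _; rewrite ler_wpM2l.
Qed.

Lemma conic_norm_continuous : {in A, continuous N}.
Proof.
move=> v; rewrite inE => Av.
have [e e0 [C C0 Nle]] := conic_norm_locally_le Av.
(* The lower bound on [N (v + h)] comes from
   [2 N v <= N (v + h) + N (v - h)]. *)
have Ndist h : `|h| < e -> `|N v - N (v + h)| <= C * `|h|.
  move=> he; have [Avh Nh] := Nle _ he.
  have := Nle (- h); rewrite normrN => /(_ he) [AvNh NNh].
  rewrite ler_norml; apply/andP; split; first by rewrite lerNl opprB lerBlDl.
  have : N (2 *: v) <= N (v + h) + N (v - h).
    have -> : 2 *: v = (v + h) + (v - h).
      by rewrite addrACA subrr addr0 scaler_nat mulr2n.
    by case: normN => _ _ _; apply.
  rewrite conic_normZ// mulr_natl mulr2n => le.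
  by rewrite lerBlDl -(lerD2r (N v)) (le_trans le)// -addrA lerD2l [leRHS]addrC.
apply/(@cvgrPdist_lt _ _ _ _ (nbhs_filter v) N (N v)) => eps eps0.
(* [C + 1] serves as divisor because [C] may be zero. *)
apply/nbhs_ballP; exists (Num.min e (eps / (C + 1))) => /=.
  by rewrite lt_min e0 divr_gt0// ltr_wpDl.
move=> y; rewrite -ball_normE /ball_/= distrC lt_min => /andP[ye].
rewrite ltr_pdivlMr ?ltr_wpDl// => yeps.
have := Ndist _ ye; rewrite [v + _]addrC subrK => /le_lt_trans; apply.
by rewrite (le_lt_trans _ yeps)// mulrC ler_wpM2l// lerDl.
Qed.

(** * Open balls and closedness of the indicatrix *)

Lemma open_conic_ball r : open (A `&` [set x | N x < r]).
Proof.
apply: ((continuous_inP N openA).1 conic_norm_continuous [set y | y < r]).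
exact: open_lt.
Qed.

Lemma open_forward_ball v r : open (forward_ball A N v r).
Proof.
have -> : forward_ball A N v r =
    (fun x => x - v) @^-1` (A `&` [set x | N x < r]).
  apply/seteqP; split => [x [[w Aw <-] Nx]|x [Ax Nx]].
    by split => //=; rewrite addrAC subrr add0r.
  by split => //=; exists (x - v) => //; rewrite addrC subrK.
apply: open_comp; last exact: open_conic_ball.
by move=> x _; apply: continuousB; [exact: cvg_id|exact: cst_continuous].
Qed.

Lemma open_backward_ball v r : open (backward_ball A N v r).
Proof.
have -> : backward_ball A N v r =
    (fun x => v - x) @^-1` (A `&` [set x | N x < r]).
  apply/seteqP; split => [x [[w Aw <-] Nx]|x [Ax Nx]].
    by split => //=; rewrite opprB addrC subrK.
  by split => //=; exists (v - x) => //; rewrite opprB addrC subrK.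
apply: open_comp; last exact: open_conic_ball.
by move=> x _; apply: continuousB; [exact: cst_continuous|exact: cvg_id].
Qed.

Lemma closed_indicatrix : closed (indicatrix A N : set (subspace A)).
Proof.
rewrite /indicatrix setIC; apply/closed_subspaceP.
(* Closedness in [subspace A] depends only on the trace on [A], so the full level set of the total
   function [N] can be used. *)
have /closed_subspaceP[C cC CA] : closed ([set x | N x = 1] : set (subspace A)).
  rewrite (_ : [set x | N x = 1] = N @^-1` [set 1])//.
  apply: preimage_closed; last exact: closed_eq.
  move=> x _; have := conic_norm_continuous.
  by rewrite -continuous_open_subspace// => /(_ x).
by exists C => //; rewrite CA -setIA setIid.
Qed.

(** * Straightening charts for the indicatrix *)

Lemma conic_norm_continuous_at v : A v -> {for v, continuous N}.
Proof. by move=> Av; apply: conic_norm_continuous; exact: mem_set. Qed.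

Lemma indicatrix_neq0 x : indicatrix A N x -> x != 0.
Proof.
move=> [Ax Nx]; apply/eqP => x0; case: normN => _ /(_ _ Ax)[_ /(_ x0)] + _ _.
by move/eqP; rewrite Nx oner_eq0.
Qed.

(* With [phi] a linear form such that [phi x = 1], the chart at [x] sends [y]
   to [y / phi y + (N y - 2) x]: its [phi]-value is [N y - 1], which vanishes
   exactly on the indicatrix, and its other coordinates give the direction
   of [y]. *)
Lemma indicatrix_hypersurface : topological_hypersurface (indicatrix A N).
Proof.
move=> x Sx; have x0 := indicatrix_neq0 Sx; have [Ax Nx] := Sx.
have [j xj] : exists j, v2r x 0 j != 0.
  apply/existsP; apply: contraNT x0 => /existsPn xj0.
  rewrite -(inj_eq (@v2r_inj R V)) linear0; apply/eqP/rowP => j.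
  by rewrite mxE; apply/eqP; rewrite -[_ == _]negbK xj0.
(* A nonzero coordinate of [x], rescaled to equal 1 at [x]; its kernel is a coordinate
   hyperplane. *)
pose psi (z : 'rV[R]_(dim V)) : R := z 0 j / v2r x 0 j.
have psi_cont : continuous psi.
  move=> z; apply: (continuousM (s := fun z : 'rV[R]_(dim V) => z 0 j)
    (t := fun=> (v2r x 0 j)^-1)); last exact: cst_continuous.
  exact: coord_continuous.
have psiD z t : psi (z + t) = psi z + psi t by rewrite /psi mxE mulrDl.
have psiZ r z : psi (r *: z) = r * psi z by rewrite /psi mxE mulrA.
pose phi y : R := psi (v2r y).
have phi_cont : continuous phi.
  move=> y; apply: (continuous_comp (f := v2r : fdspace V -> _)
    (g := psi)); last exact: psi_cont.
  exact: v2r_continuous.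
have phiD y w : phi (y + w) = phi y + phi w by rewrite /phi linearD psiD.
have phiZ r y : phi (r *: y) = r * phi y by rewrite /phi linearZ psiZ.
have phix : phi x = 1 by rewrite /phi /psi divff.
have phir z : phi (r2v z) = psi z by rewrite /phi r2vK.
(* Projection along [x] onto the affine hyperplane [phi = 1]. It recovers the direction of [y] from
   [f y], since [u (f y)] is [y / phi y]. *)
pose u z : fdspace V := r2v z + (1 - psi z) *: x.
have phiu z : phi (u z) = 1 by rewrite phiD phiZ phix phir mulr1 addrC subrK.
have u_cont : continuous u.
  move=> z; apply: continuousD; first exact: r2v_continuous.
  apply: continuousZr_tmp; apply: continuousB; first exact: cst_continuous.
  exact: psi_cont.
have Nu_gt0 z : A (u z) -> 0 < N (u z).
  move=> Au; apply: conic_norm_gt0 => //; apply/eqP => uz0.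
  have := phiu z; rewrite uz0 -(scale0r x) phiZ mul0r => /eqP.
  by rewrite eq_sym oner_eq0.
pose f y := v2r ((phi y)^-1 *: y + (N y - 2) *: x).
(* The point on the ray of [u z] where [N] equals [1 + psi z], because [psi (f y) = N y - 1]. *)
pose g z : fdspace V := ((1 + psi z) / N (u z)) *: u z.
have psif y : 0 < phi y -> psi (f y) = N y - 1.
  move=> py; rewrite -/(phi _) phiD !phiZ phix mulVf ?gt_eqF// mulr1.
  by ring.
have uf y : 0 < phi y -> u (f y) = (phi y)^-1 *: y.
  move=> py; rewrite /u psif// v2rK -addrA -scalerDl.
  by rewrite (_ : N y - 2 + _ = 0) ?scale0r ?addr0//; ring.
have Ng z : A (u z) -> -1 < psi z -> N (g z) = 1 + psi z.
  move=> Au pz; have Nu := Nu_gt0 _ Au.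
  have p0 : 0 < 1 + psi z by rewrite -ltrBlDl sub0r.
  by rewrite conic_normZ ?divr_gt0// divfK// gt_eqF.
have [H [dimH HE]] := coord_hyperplane R j.
(* On the half-space [phi > 0], dividing by [phi] stays on the open ray of [y]. The bound [-1 < psi]
   in [W] mirrors [N y > 0]. *)
pose U := A `&` [set y | 0 < phi y].
pose W := (u @^-1` A) `&` [set z | -1 < psi z].
have Ug z : W z -> U (g z).
  move=> [Au pz]; have Nu := Nu_gt0 _ Au.
  have p0 : 0 < 1 + psi z by rewrite -ltrBlDl sub0r.
  split; first by apply: conicZ => //; exact: divr_gt0.
  by rewrite /= phiZ phiu mulr1 divr_gt0.
have Wf y : U y -> W (f y).
  move=> [Ay py]; split => /=.
    by rewrite uf//; apply: conicZ => //; rewrite invr_gt0.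
  rewrite psif// ltrBDr addNr conic_norm_gt0//; apply/eqP => y0.
  by move: py; rewrite y0 -(scale0r x) /= phiZ mul0r ltxx.
have gf y : U y -> g (f y) = y.
  move=> [Ay py]; have [Au _] := Wf _ (conj Ay py); have := Nu_gt0 _ Au.
  rewrite /g psif// uf// addrC subrK => Nu.
  rewrite conic_normZ ?invr_gt0//; rewrite conic_normZ ?invr_gt0// in Nu.
  have Ny : N y != 0.
    by apply: contraTneq Nu => ->; rewrite mulr0 ltxx.
  by rewrite scalerA invfM invrK mulrCA divff// mulr1 divff ?scale1r// gt_eqF.
have fg z : W z -> f (g z) = z.
  move=> Wz; have [_ pg] := Ug _ Wz; have [Au pz] := Wz.
  have p0 : 0 < 1 + psi z by rewrite -ltrBlDl sub0r.
  have Nu := Nu_gt0 _ Au.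
  rewrite /f Ng// /g phiZ phiu mulr1 scalerA mulVf ?gt_eqF ?divr_gt0// scale1r.
  rewrite -addrA -scalerDl.
  rewrite (_ : 1 - psi z + (1 + psi z - 2) = 0).
    by rewrite scale0r addr0 r2vK.
  by ring.
exists U, W, f, g, H; split => //.
- split=> //; last by split; rewrite //= phix.
  apply: openI => //; apply: (open_comp (f := phi) (D := [set t | 0 < t])).
    by move=> y _; exact: phi_cont.
  exact: open_gt.
- apply: openI.
    by apply: open_comp => // z _; exact: u_cont.
  apply: (open_comp (f := psi) (D := [set t | -1 < t])).
    by move=> z _; exact: psi_cont.
  exact: open_gt.
- split.
  + by move=> y Uy; split; [exact: Wf|exact: gf].
  + by move=> z Wz; split; [exact: Ug|exact: fg].
  + apply: continuous_in_subspaceT => y; rewrite inE => -[Ay py].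
    apply: (continuous_comp (f := fun y => (phi y)^-1 *: y + (N y - 2) *: x)
      (g := v2r : fdspace V -> _)); last exact: v2r_continuous.
    apply: continuousD.
      apply: continuousZ; last exact: cvg_id.
      by apply: continuousV; [rewrite gt_eqF|exact: phi_cont].
    apply: continuousZr_tmp; apply: continuousB; last exact: cst_continuous.
    exact: conic_norm_continuous_at.
  + apply: continuous_in_subspaceT => z; rewrite inE => -[Au pz].
    apply: (continuousZ (s := fun z => (1 + psi z) / N (u z)));
      last exact: u_cont.
    apply: (continuousM (s := fun z => 1 + psi z)
      (t := fun z => (N (u z))^-1)).
      by apply: continuousD; [exact: cst_continuous|exact: psi_cont].
    apply: continuousV; first by rewrite gt_eqF// Nu_gt0.
    apply: (continuous_comp (f := u) (g := N)); first exact: u_cont.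
    exact: conic_norm_continuous_at.
- have HP z : (z \in H) <-> psi z = 0.
    rewrite HE /psi; split => [/eqP ->|/eqP]; first by rewrite mul0r.
    by rewrite mulf_eq0 invr_eq0 (negPf xj) orbF.
  apply/seteqP; split => [_ [y [Uy [_ Ny]] <-]|z [Wz /HP pz]].
    split; first exact: Wf.
    by apply/HP; rewrite psif ?Ny ?subrr//; case: Uy.
  exists (g z); last exact: fg.
  have [Ag pg] := Ug _ Wz; have [Au pz1] := Wz.
  by split=> //; split=> //=; rewrite Ng// pz addr0.
Qed.

(** * Radial comparison with a Euclidean sphere *)

Lemma dot_continuous (B : {dot fdspace V for @idfun R}) :
  continuous (fun x : fdspace V => B x x).
Proof.
(* By bilinearity [B x x] is a quadratic polynomial in the coordinates, which are continuous. *)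
have -> : (fun x : fdspace V => B x x) = (fun x : fdspace V =>
    \sum_i \sum_j v2r x 0 i * (v2r x 0 j * B (r2v 'e_i) (r2v 'e_j))).
  apply/funext => x; rewrite {1 2}(fdspace_sum_coord x) linear_sumlz.
  apply: eq_bigr => i _; rewrite linearZl_LR linear_sumr /= mulr_sumr.
  by apply: eq_bigr => j _; rewrite linearZr_LR.
have coordc i : continuous (fun x : fdspace V => v2r x 0 i).
  move=> x; apply: (continuous_comp (f := v2r : fdspace V -> _)
    (g := fun z : 'rV[R]_(dim V) => z 0 i)); first exact: v2r_continuous.
  exact: coord_continuous.
apply: continuous_big => [|i _]; first exact: add_continuous.
apply: continuous_big => [|j _]; first exact: add_continuous.
move=> x; apply: (continuousM (s := fun x : fdspace V => v2r x 0 i)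
  (t := fun x : fdspace V => v2r x 0 j * B (r2v 'e_i) (r2v 'e_j))).
  exact: coordc.
apply: (continuousM (s := fun x : fdspace V => v2r x 0 j)
  (t := fun=> B (r2v 'e_i) (r2v 'e_j))); first exact: coordc.
exact: cst_continuous.
Qed.

(** Each map slides points along their open rays, which stay in [A], to the unit level of one norm;
    the two are therefore mutually inverse. Both sets avoid [0], even when [A] is all of [V], so no
    division degenerates. *)
Lemma indicatrix_homeomorphic_sphere (B : {dot fdspace V for @idfun R}) :
  homeomorphic_sets (indicatrix A N) (euclidean_sphere B `&` A).
Proof.
have B_gt0 x : x != 0 -> 0 < B x x by exact: neq0_dnorm_gt0.
have BZ r x : B (r *: x) (r *: x) = r ^+ 2 * B x x.
  by rewrite linearZl_LR linearZr_LR /= mulrA.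
have sB_gt0 x : x != 0 -> 0 < Num.sqrt (B x x).
  by move=> /B_gt0; rewrite sqrtr_gt0.
have sphere_neq0 x : euclidean_sphere B x -> x != 0.
  rewrite /euclidean_sphere/= => Bx; apply/eqP => x0; move: Bx.
  by rewrite x0 linear0l => /eqP; rewrite eq_sym oner_eq0.
exists (fun x => (Num.sqrt (B x x))^-1 *: x), (fun y => (N y)^-1 *: y); split.
- move=> x Sx; have x0 := indicatrix_neq0 Sx; have [Ax Nx] := Sx.
  have s0 := sB_gt0 _ x0.
  have si0 : 0 < (Num.sqrt (B x x))^-1 by rewrite invr_gt0.
  split; last first.
    rewrite conic_normZ// [N x]Nx mulr1 invrK scalerA divff ?scale1r//.
    by rewrite gt_eqF.
  split; last exact: conicZ.
  rewrite /euclidean_sphere/= BZ exprVn sqr_sqrtr ?ltW ?B_gt0//.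
  by rewrite mulVf// gt_eqF// B_gt0.
- move=> y [By Ay]; have y0 := sphere_neq0 _ By.
  have Ny := conic_norm_gt0 Ay y0.
  have Niy : 0 < (N y)^-1 by rewrite invr_gt0.
  split.
    split; first exact: conicZ.
    by rewrite /= conic_normZ// mulVf// gt_eqF.
  rewrite BZ [B y y]By mulr1 sqrtr_sqr gtr0_norm// invrK scalerA.
  by rewrite divff ?scale1r// gt_eqF.
- apply: continuous_in_subspaceT => x; rewrite inE => Sx.
  apply: (continuousZ (s := fun x => (Num.sqrt (B x x))^-1) (f := id));
    last exact: cvg_id.
  apply: continuousV; first by rewrite gt_eqF// sB_gt0// indicatrix_neq0.
  apply: (continuous_comp (f := fun x => B x x) (g := Num.sqrt)).
    exact: dot_continuous.
  exact: sqrt_continuous.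
- apply: continuous_in_subspaceT => y; rewrite inE => -[By Ay].
  apply: (continuousZ (s := fun y => (N y)^-1) (f := id));
    last exact: cvg_id.
  apply: continuousV; last exact: conic_norm_continuous_at.
  by rewrite gt_eqF// conic_norm_gt0// sphere_neq0.
Qed.

End ConicNorm.

Theorem proposition2p11 (R : realType) (V : vectType R)
    (A : set (fdspace V)) (N : fdspace V -> R)
    (openA : open A) (convexA : convex_set A) (conicA : conic A)
    (normN : conic_norm A N) :
  [/\ {within A, continuous N},
      forall (v : fdspace V) (r : R), 0 < r ->
        open (forward_ball A N v r) /\ open (backward_ball A N v r),
      topological_hypersurface (indicatrix A N),
      closed (indicatrix A N : set (subspace A))
    & forall B : {dot fdspace V for @idfun R},
        exists U : set (fdspace V),
          [/\ U `<=` euclidean_sphere B,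
              open (U : set (subspace (euclidean_sphere B)))
            & homeomorphic_sets (indicatrix A N) U]].
Proof.
split.
- rewrite continuous_open_subspace//; exact: conic_norm_continuous.
- by move=> v r _; split; [exact: open_forward_ball|exact: open_backward_ball].
- exact: indicatrix_hypersurface.
- exact: closed_indicatrix.
- move=> B; exists (euclidean_sphere B `&` A); split.
  + exact: subIsetl.
  (* Relative openness in the sphere is inherited from openness of [A] in [V]. *)
  + by rewrite setIC open_subspaceIT; exact: open_subspaceW.
  + exact: indicatrix_homeomorphic_sphere.
Qed.
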